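(* Let $n\ge 1$ and $0\le k\le n$ be integers. There is a constant $c$ depending only on $n$ and $k$ such that for every real $B\ge 1$ there exist at most $$c\,B^{\frac{(n+1)(n-k)}{n}}$$ $k$-planes in $\mathbb{P}^n_{\mathbb{Q}}$ that jointly contain all rational points of height $\le B$ in $\mathbb{P}^n$.
   Context: A $k$-plane in $\mathbb{P}^n_{\mathbb{Q}}$ is a $k$-dimensional linear subvariety (defined over $\mathbb{Q}$). A rational point of $\mathbb{P}^n$ has height $\le B$ if it can be written in homogeneous integer coordinates $(x_0,\dots,x_n)$ (not all zero) with $|x_0|,\dots,|x_n|\le B$. *)

(* Defs.v *)
From mathcomp Require Import all_boot all_order all_algebra.
From mathcomp Require Import all_classical all_reals all_analysis.

Set Implicit Arguments.
Unset Strict Implicit.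
Unset Printing Implicit Defensive.

Import Order.TTheory GRing.Theory Num.Theory.
Local Open Scope ring_scope.

(* A linear subvariety of P^n over Q is encoded by the Q-linear subspace of
   Q^(n+1) lying over it; the projective dimension is one less than the linear
   one. Incidence and inclusion become inclusion of subspaces. *)
Definition linear_subvariety (n : nat) := {vspace 'rV[rat]_n.+1}.

Definition is_plane (n k : nat) (L : linear_subvariety n) : bool :=
  \dim L == k.+1.

(* A point is given by a 0-plane, that is a line through the origin. *)
Definition is_point (n : nat) (P : linear_subvariety n) : bool := is_plane 0 P.

(* The coordinates x need not be coprime. *)
Definition height_le (R : realType) (n : nat) (P : linear_subvariety n)
    (B : R) : Prop :=
  exists x : 'rV[int]_n.+1,
    [/\ x != 0,
        P = <[map_mx intr x]>%VS &
        forall i : 'I_n.+1, (`|x 0 i|)%:~R <= B].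

(* Main.v *)
Require Import Defs.
From mathcomp Require Import all_boot all_order all_algebra.
From mathcomp Require Import all_classical all_reals all_analysis.
From mathcomp Require Import zify ring.

(** Write N = n + 1 and m = n - k.  For k = 0 one lists the points themselves;
    there are O(B^N) of them (cover_by_points).

    For k > 0, a k-plane is the orthogonal space of m independent integer
    vectors, so it suffices to find, for each integer point x with coordinates
    at most B, independent y_1, ..., y_m orthogonal to x that come from a list
    with O(B^(Nm/n)) members.  The y_i are taken to realise the first m
    successive minima l_1 <= ... <= l_m, for the sup norm, of the lattice of
    integer vectors orthogonal to x.  As this lattice has rank n and
    determinant at most a constant times B, Minkowski's second theorem gives
        l_1 ... l_m * l_m^(n - m) = O(B).
    This inequality is obtained here by pigeonhole instead of volumes.  Let V_j
    be the span of y_1, ..., y_j, and count the classes modulo V_j of the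
    integer points of the cube [0, L)^N.  The count for V_(j-1) and for V_j is
    the same at L = l_j, because all the short vectors orthogonal to x lie in
    V_(j-1) (packing_sub); and replacing L by L' >= L multiplies the count for
    V_j by at least a constant times (L'/L)^(N-j), because the quotient has
    dimension N - j (packing_scale).  So modulo V_m the cube of side l_m
    has at least a constant times l_1 ... l_m * l_m^(N-m) classes.  These are
    separated by their scalar product with x, which takes O(B l_m) values
    (packing_dot).

    It remains to count the systems (y_1, ..., y_m) of increasing norms with
        |y_1| ... |y_m| * l^(n-m) <= X, where all |y_i| <= l.
    Fixing the shortest vector y_1 leaves the same problem for n - 1, m - 1 and
    X / |y_1|, and |y_1| <= X^(1/n); so the bound O(X^(Nm/n)) follows by
    induction from the estimate of the sum of |y|^(-s) over 0 < |y| <= Y by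
    Y^(N-s), where s = N (m-1) / (n-1) (count_systems).  That estimate requires
    s < N, that is m < n: for m = n the argument would lose a logarithm, which
    is the reason for treating points apart. *)

Set Implicit Arguments.
Unset Strict Implicit.
Unset Printing Implicit Defensive.

Import Order.TTheory GRing.Theory Num.Theory.
Local Open Scope ring_scope.

(** * Integer vectors *)

Definition ratv N (z : 'rV[int]_N) : 'rV[rat]_N := map_mx intr z.
Definition supn N (z : 'rV[int]_N) : nat := \max_i absz (z 0%R i).
Definition dot N (x z : 'rV[int]_N) : int := \sum_i x 0 i * z 0 i.

Lemma ratvB N (a b : 'rV[int]_N) : ratv (a - b) = ratv a - ratv b.
Proof. by rewrite /ratv map_mxB. Qed.

Lemma ratvD N (a b : 'rV[int]_N) : ratv (a + b) = ratv a + ratv b.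
Proof. by rewrite /ratv map_mxD. Qed.

Lemma supn_ge N (z : 'rV[int]_N) i : (absz (z 0%R i) <= supn z)%N.
Proof. exact: (leq_bigmax i). Qed.

Lemma supn_leP N (z : 'rV[int]_N) l :
  reflect (forall i, absz (z 0%R i) <= l)%N (supn z <= l)%N.
Proof.
apply: (iffP idP) => [le i|le]; first exact: leq_trans (supn_ge z i) le.
by apply/bigmax_leqP => i _.
Qed.

Lemma supn_gt0 N (z : 'rV[int]_N) : (0 < supn z)%N = (z != 0).
Proof.
rewrite lt0n; congr negb; apply/eqP/eqP => [z0|->].
  apply/rowP => i; have := supn_ge z i; rewrite z0 leqn0 absz_eq0 mxE.
  by move=> /eqP.
by apply/eqP; rewrite -leqn0; apply/supn_leP => i; rewrite mxE.
Qed.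

Lemma dotB N (x a b : 'rV[int]_N) : dot x (a - b) = dot x a - dot x b.
Proof.
by rewrite /dot -sumrB; apply: eq_bigr => i _; rewrite !mxE mulrBr.
Qed.

Lemma dotC N (x z : 'rV[int]_N) : dot x z = dot z x.
Proof. by apply: eq_bigr => i _; rewrite mulrC. Qed.

Lemma supn_le_truncn (R : realType) N (x : 'rV[int]_N) (B : R) : 0 <= B ->
  (forall i, (`|x 0 i|)%:~R <= B) -> (supn x <= Num.truncn B)%N.
Proof.
move=> B0 xB; apply/supn_leP => i; rewrite truncn_ge_nat //.
by have := xB i; rewrite -abszE -pmulrn.
Qed.

Lemma int_multiple N (w : 'rV[rat]_N) :
  exists2 c : rat, c != 0 & exists z, ratv z = c *: w.
Proof.
exists (\prod_i (denq (w 0 i))%:~R).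
  by apply/prodf_neq0 => i _; rewrite intr_eq0 denq_neq0.
exists (\row_i (numq (w 0 i) * \prod_(j | j != i) denq (w 0 j))).
apply/rowP => i; rewrite !mxE [in RHS](bigD1 i) //= intrM rmorph_prod /=.
by rewrite numqE; ring.
Qed.

(** * Coordinates bounded by one *)

(** Expanding along row s: the cofactors of that row are those of the identity. *)
Lemma det_replace_row (F : comRingType) d (M : 'M[F]_d) (s : 'I_d) :
  (forall i, i != s -> row i M = row i 1%:M) -> \det M = M s s.
Proof.
move=> eqM; rewrite (expand_det_row _ s).
under eq_bigr => j _.
  have -> : cofactor M s j = (j == s)%:R.
    transitivity (cofactor (1%:M : 'M[F]_d) s j).
      rewrite /cofactor; congr (_ * \det _); apply/matrixP => i l; rewrite !mxE.
      have nsi : lift s i != s by rewrite eq_sym neq_lift.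
      have /rowP/(_ (lift j l)) := eqM _ nsi.
      by rewrite !mxE.
    have /matrixP/(_ j s) := adj1 F d.
    by rewrite !mxE.
  over.
rewrite (bigD1 s) //= eqxx mulr1 big1 ?addr0 // => j /negPf ->.
by rewrite mulr0.
Qed.

(** By Cramer's rule: if the rows f have the largest minor in absolute value,
    then the coordinates of the other rows of A in the basis made of those rows
    are quotients of minors, hence at most 1. *)
Lemma bounded_coordinates N d (A : 'M[rat]_(N, d)) : \rank A = d ->
  exists (f : 'I_d -> 'I_N) (P : 'M[rat]_d),
    rowsub f (A *m P) = 1%:M /\ forall t s, `|(A *m P) t s| <= 1.
Proof.
move=> rkA.
have fA : row_full A by rewrite /row_full rkA.
pose w (f : {ffun 'I_d -> 'I_N}) := `|\det (rowsub f A)|.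
have [f _ fmax] := @arg_maxP _ _ _ (fullrankfun fA) xpredT w isT.
have /eqP detf : w f != 0.
  have : w (fullrankfun fA) != 0.
    have := fullrowsub_unit fA; rewrite unitmxE unitfE => /negPf h.
    by rewrite /w normr_eq0 h.
  have : w (fullrankfun fA) <= w f := fmax _ isT.
  by rewrite /w => le0; rewrite -!normr_gt0 !normr_id => /lt_le_trans; apply.
have unitf : rowsub f A \in unitmx.
  by rewrite unitmxE unitfE -normr_eq0; apply/eqP.
exists f, (invmx (rowsub f A)).
have fP : rowsub f (A *m invmx (rowsub f A)) = 1%:M.
  by rewrite -mul_rowsub_mx mulmxV.
split=> // t s; set P := A *m _.
(* The minor of the rows f with the s-th one replaced by t is P t s times the
   maximal one. *)
pose g := [ffun i => if i == s then t else f i].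
have detg : \det (rowsub g P) = P t s.
  rewrite (@det_replace_row _ _ _ s); first by rewrite mxE ffunE eqxx.
  move=> i /negPf ns; rewrite -fP; apply/rowP => j; rewrite !mxE /=.
  by rewrite ffunE ns.
have eqg : rowsub g A = rowsub g P *m rowsub f A.
  by rewrite mul_rowsub_mx /P mulmxKV.
have : w g <= w f := fmax g isT.
rewrite /w eqg det_mulmx normrM detg.
by rewrite ger_pMl // lt_def normr_ge0 andbT; apply/eqP.
Qed.

(** The columns of A serve as independent coordinates on the quotient by the
    span of ys; they are a basis of the linear equations of that span. *)
Lemma annihilator N (ys : seq 'rV[rat]_N) :
  exists d (A : 'M[rat]_(N, d)),
    [/\ (N - size ys <= d)%N, \rank A = d & {in <<ys>>%VS, forall v, v *m A = 0}].
Proof.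
pose M : 'M[rat]_(size ys, N) := \matrix_(i, j) (nth 0 ys i) 0 j.
pose r := \rank (kermx M^T); pose A : 'M[rat]_(N, r) := (row_base (kermx M^T))^T.
exists r, A; split.
- by rewrite /r mxrank_ker mxrank_tr leq_sub2l // rank_leq_row.
- by rewrite mxrank_tr eq_row_base.
suff /subvP sub : (<<ys>> <= lker (linfun (mulmxr A)))%VS.
  by move=> v /sub; rewrite memv_ker lfunE /= => /eqP.
apply/span_subvP => y yin; rewrite memv_ker lfunE /=.
have kM : row_base (kermx M^T) *m M^T = 0.
  by apply/sub_kermxP; rewrite eq_row_base.
have MA : M *m A = 0 by rewrite -[LHS]trmxK trmx_mul trmxK kM trmx0.
have ylt : (index y ys < size ys)%N by rewrite index_mem.
have yE : y = row (Ordinal ylt) M.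
  by apply/rowP => j; rewrite !mxE nth_index.
by rewrite yE -row_mul MA row0.
Qed.

(** * Classes of a cube modulo a subspace *)

(** The cube [0, L)^N contains at least K integer vectors that are pairwise
    incongruent modulo V.  The family is indexed by a type so that the products
    of families needed for scaling are again of this form. *)
Definition packing N (V : {vspace 'rV[rat]_N}) (L K : nat) : Prop :=
  exists (T : finType) (F : T -> 'rV[int]_N),
    [/\ (K <= #|T|)%N, forall t i, 0 <= F t 0 i < L%:Z &
        forall t t', ratv (F t - F t') \in V -> t = t'].

Lemma absz_subr_ltn (a b : int) L : (0 < L)%N ->
  0 <= a < L%:Z -> 0 <= b < L%:Z -> (absz (a - b) <= L.-1)%N.
Proof. lia. Qed.

Lemma packing1 N (V : {vspace 'rV[rat]_N}) : packing V 1 1.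
Proof.
exists unit, (fun=> 0); split; first by rewrite card_unit.
- by move=> _ i; rewrite mxE.
- by move=> [] [].
Qed.

(** A difference of two vectors of the cube has norm less than L, so only the
    short integer vectors of V' matter. *)
Lemma packing_sub N (V V' : {vspace 'rV[rat]_N}) L K : (0 < L)%N ->
  (forall z, ratv z \in V' -> (supn z < L)%N -> ratv z \in V) ->
  packing V L K -> packing V' L K.
Proof.
move=> L0 sub [T [F [cT bF injF]]]; exists T, F; split=> // t t' /sub h.
apply: injF; apply: h; rewrite -(ltn_predK L0) ltnS; apply/supn_leP => i.
by rewrite !mxE; apply: absz_subr_ltn.
Qed.

(** The scalar product with x separates the classes and takes fewer than
    2 N b L values on the cube. *)
Lemma packing_dot N (V : {vspace 'rV[rat]_N}) (x : 'rV[int]_N) b L K :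
  (0 < N)%N -> (0 < b)%N -> (0 < L)%N -> (supn x <= b)%N ->
  (forall z, dot x z = 0 -> (supn z < L)%N -> ratv z \in V) ->
  packing V L K -> (K <= 2 * N * b * L)%N.
Proof.
move=> N0 b0 L0 xb sub [T [F [cT bF injF]]]; apply: leq_trans cT _.
have bd t : `|dot x (F t)| < (N * b * L)%:Z.
  apply: (@le_lt_trans _ _ (N * b * L.-1)%:Z); last first.
    by rewrite ltz_nat ltn_pmul2l ?muln_gt0 ?N0 ?prednK.
  rewrite /dot; apply: (le_trans (ler_norm_sum _ _ _)).
  apply: (@le_trans _ _ (\sum_(i < N) (b * L.-1)%:Z)).
    apply: ler_sum => i _; rewrite normrM PoszM.
    apply: ler_pM => //; first by rewrite -abszE lez_nat (leq_trans (supn_ge x i)).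
    by move: (F t 0 i) (bF t i) => a; lia.
  by rewrite sumr_const card_ord -mulr_natl natz -mulnA (PoszM N).
have G_lt t : (absz (dot x (F t) + (N * b * L)%:Z)%R < 2 * N * b * L)%N.
  by move: (dot _ _) (bd t) => a; lia.
pose G t := Ordinal (G_lt t).
rewrite -[leqRHS]card_ord; apply: (@leq_card _ _ G).
move=> t t' /(congr1 val) /= eqG; apply: injF; apply: sub.
  rewrite dotB; move: eqG (bd t) (bd t').
  by move: (dot _ _) (dot _ _) => a a'; lia.
rewrite -(ltn_predK L0) ltnS; apply/supn_leP => i.
by rewrite !mxE; apply: absz_subr_ltn.
Qed.

(** Take coordinates psi on the quotient by the span, such that d of the standard
    basis vectors map to the basis and all others have coordinates at most 1.
    The image of the cube of side L then has width less than N L in each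
    coordinate, so its translates by N L times the points of {0, ..., q-1}^d are
    disjoint; and they fit in the cube of side L'. *)
Lemma packing_scale N (ys : seq 'rV[rat]_N) L L' K :
  (0 < N)%N -> (0 < L <= L')%N -> packing <<ys>>%VS L K ->
  exists2 q, (L' <= 2 * N * L * q)%N &
    packing <<ys>>%VS L' (q ^ (N - size ys) * K).
Proof.
move=> N0 /andP[L0 LL'] [T [F [cT bF injF]]].
have NL0 : (0 < N * L)%N by rewrite muln_gt0 N0.
(* When L' < N L only the trivial translate fits; the loss is a constant. *)
pose q := maxn 1 (L' %/ (N * L)).
have q0 : (0 < q)%N by rewrite leq_max.
have fit : (N * L * q.-1 + L <= L')%N.
  rewrite /q; case: (ltngtP 1 (L' %/ (N * L))) => h /=; rewrite ?muln0 //.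
  apply: leq_trans (leq_divM L' (N * L)); move: h.
  case: (L' %/ (N * L))%N => //= p _.
  by rewrite mulSn addnC mulnC leq_add2r leq_pmull.
exists q.
  have := ltn_ceil L' NL0; rewrite -/(L' %/ (N * L))%N => h.
  apply: leq_trans (ltnW h) _.
  rewrite (_ : (2 * N * L * q = (2 * q) * (N * L))%N); last by ring.
  by rewrite leq_pmul2r //; lia.
have [d [A [dge rkA annA]]] := annihilator ys.
have [f [P [fI P1]]] := bounded_coordinates rkA.
set psi := A *m P in fI P1.
have psi0 v : v \in <<ys>>%VS -> v *m psi = 0.
  by move=> /annA; rewrite /psi mulmxA => ->; rewrite mul0mx.
have f_inj : injective f.
  move=> s s' eqf; have /matrixP/(_ s s') := fI; have /matrixP/(_ s' s') := fI.
  rewrite !mxE eqxx -eqf => -> /eqP.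
  by case: (s =P s') => // _; rewrite oner_eq0.
pose w (u : {ffun 'I_d -> 'I_q}) : 'rV[int]_N :=
  \sum_s (N * L * u s)%:Z *: delta_mx 0 (f s).
have wE u s : (ratv (w u) *m psi) 0 s = (N * L * u s)%:R.
  rewrite /w /ratv raddf_sum /= mulmx_suml summxE (bigD1 s) //= big1.
    rewrite addr0 map_mxZ map_delta_mx -scalemxAl -rowE mxE.
    have /matrixP/(_ s s) := fI; rewrite !mxE eqxx => ->.
    by rewrite mulr1 /=.
  move=> s' /negPf ns; rewrite map_mxZ map_delta_mx -scalemxAl -rowE mxE.
  have /matrixP/(_ s' s) := fI; rewrite !mxE ns => ->.
  by rewrite mulr0.
have w_bd u i : 0 <= w u 0 i <= (N * L * q.-1)%:Z.
  rewrite /w summxE.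
  have [s /eqP fs|nof] := pickP (fun s => f s == i).
    rewrite (bigD1 s) //= big1.
      rewrite !mxE fs !eqxx addr0 mulr1 lez_nat leq_pmul2l //.
      by rewrite -ltnS prednK // ltn_ord.
    move=> s' ns; rewrite !mxE eqxx -fs (inj_eq f_inj) eq_sym (negPf ns).
    by rewrite mulr0.
  rewrite big1 => [|s _]; first by rewrite lexx lez_nat.
  by rewrite !mxE eqxx eq_sym (nof s) mulr0.
have diff_lt t t' s : `|(ratv (F t - F t') *m psi) 0 s| < (N * L)%:R.
  apply: (@le_lt_trans _ _ (N * L.-1)%:R); last first.
    by rewrite ltr_nat ltn_pmul2l // ltn_predL.
  rewrite mxE; apply: (le_trans (ler_norm_sum _ _ _)).
  apply: (@le_trans _ _ (\sum_(i < N) (L.-1)%:R : rat)); last first.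
    by rewrite sumr_const card_ord natrM mulr_natl.
  apply: ler_sum => i _; rewrite normrM -[leRHS]mulr1.
  apply: ler_pM => //; rewrite !mxE -intr_norm.
  rewrite [leRHS]pmulrn ler_int.
  by rewrite -abszE lez_nat absz_subr_ltn.
exists ({ffun 'I_d -> 'I_q} * T)%type, (fun p => F p.2 + w p.1); split.
- rewrite card_prod card_ffun !card_ord leq_mul //.
  by rewrite leq_pexp2l.
- move=> [u t] i; rewrite mxE /=.
  by move: (F t 0 i) (w u 0 i) (bF t i) (w_bd u i) => a b; lia.
move=> [u t] [u' t'] /= inV.
(* The coordinates determine the translate. *)
have eqw : forall s, u s = u' s.
  move=> s; have /rowP/(_ s) := psi0 _ inV; rewrite [RHS]mxE.
  rewrite (_ : _ + _ - _ = (F t - F t') + (w u - w u')); last first.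
    by rewrite opprD addrACA.
  have rowD (a b : 'rV[rat]_d) : (a + b) 0 s = a 0 s + b 0 s by rewrite mxE.
  have rowB (a b : 'rV[rat]_d) : (a - b) 0 s = a 0 s - b 0 s by rewrite !mxE.
  rewrite ratvD mulmxDl (ratvB (w u)) mulmxBl rowD rowB !wE => eq0.
  have := diff_lt t t' s.
  have -> : (ratv (F t - F t') *m psi) 0 s = (N * L * u' s)%:R - (N * L * u s)%:R.
    by apply/eqP; rewrite -subr_eq0 -eq0; apply/eqP; ring.
  rewrite !pmulrn -rmorphB -intr_norm ltr_int => lt.
  apply/val_inj => /=; move: lt; rewrite !(PoszM (N * L)) -mulrBr normrM.
  have -> : `|(N * L)%:Z| = (N * L)%:Z by [].
  rewrite gtr_pMr ?ltz_nat //.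
  by move: (nat_of_ord (u s)) (nat_of_ord (u' s)) => a b; lia.
have /ffunP eu : u =1 u' := eqw; rewrite eu in inV *.
congr (_, _); apply: injF.
by rewrite opprD addrACA subrr addr0 in inV.
Qed.

(** * Orthogonal spaces *)

Definition columns N (ys : seq 'rV[int]_N) : 'M[rat]_(N, size ys) :=
  \matrix_(j, i) (nth 0 ys i 0 j)%:~R.

Definition orth N (ys : seq 'rV[int]_N) : {vspace 'rV[rat]_N} :=
  lker (linfun (mulmxr (columns ys)) : 'Hom('rV[rat]_N, 'rV[rat]_(size ys))).

Lemma orthP N (ys : seq 'rV[int]_N) z :
  reflect {in ys, forall y, dot y z = 0} (ratv z \in orth ys).
Proof.
have E i : (ratv z *m columns ys) 0 i = (dot (nth 0 ys i) z)%:~R.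
  rewrite mxE rmorph_sum; apply: eq_bigr => j _.
  by rewrite !mxE rmorphM mulrC.
rewrite memv_ker lfunE /=; apply: (iffP eqP) => [h y yin|h].
  have ylt : (index y ys < size ys)%N by rewrite index_mem.
  have := E (Ordinal ylt); rewrite h mxE /= nth_index // => /esym/eqP.
  by rewrite intr_eq0 => /eqP.
by apply/rowP => i; rewrite E mxE h ?mem_nth.
Qed.

Lemma dim_rows n : \dim (fullv : {vspace 'rV[rat]_n}) = n.
Proof. by rewrite dimvf /dim /= mul1n. Qed.

Lemma dim_orth_ge N (ys : seq 'rV[int]_N) : (N - size ys <= \dim (orth ys))%N.
Proof.
set h : 'Hom('rV[rat]_N, 'rV[rat]_(size ys)) := linfun (mulmxr (columns ys)).
have := limg_ker_dim h fullv; rewrite capfv dim_rows.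
have : (\dim (h @: fullv) <= size ys)%N.
  by rewrite -[leqRHS]dim_rows dimvS ?subvf.
by move=> le eqN; rewrite leq_subLR -[leqLHS]eqN addnC leq_add2r.
Qed.

(** The rows being independent, the map is onto, whence equality. *)
Lemma dim_orth_free N (ys : seq 'rV[int]_N) :
  free (map (@ratv N) ys) -> \dim (orth ys) = (N - size ys)%N.
Proof.
move=> fr; set Y := columns ys.
set h : 'Hom('rV[rat]_N, 'rV[rat]_(size ys)) := linfun (mulmxr Y).
have Yfree : row_free Y^T.
  apply: inj_row_free => v v0; apply/rowP => i; rewrite mxE.
  apply: (freeP (X := map_tuple (@ratv N) (in_tuple ys)) fr (v 0)).
  rewrite -[RHS]v0 mulmx_sum_row; apply: eq_bigr => l _; congr (_ *: _).
  by apply/rowP => t; rewrite (nth_map 0) // !mxE.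
have himg : (h @: fullv = fullv)%VS.
  have [B YB] := row_freeP Yfree.
  apply/eqP; rewrite eqEsubv subvf /=; apply/subvP => w _.
  have -> : w = h (w *m B^T).
    by rewrite lfunE /= -mulmxA -[Y]trmxK -trmx_mul YB trmx1 mulmx1.
  exact/memv_img/memvf.
have := limg_ker_dim h fullv; rewrite capfv himg !dim_rows.
by move/(congr1 (subn^~ (size ys))); rewrite addnK.
Qed.

(** * Successive minima of the vectors orthogonal to a point *)

(** The orthogonal space of x has dimension at least N - 1; clear denominators
    in a vector of it that is not in V. *)
Lemma exists_orth_outside N (x : 'rV[int]_N) (V : {vspace 'rV[rat]_N}) :
  (\dim V < N.-1)%N -> exists2 z, dot x z = 0 & ratv z \notin V.
Proof.
move=> dV; have dimH := dim_orth_ge [:: x]; rewrite subn1 in dimH.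
have /subvPn [v vH vV] : ~~ (orth [:: x] <= V)%VS.
  by apply: contraL (leq_trans dV dimH) => /dimvS; rewrite -leqNgt.
have [c c0 [z zE]] := int_multiple v.
exists z; last first.
  by rewrite zE; apply: contraNN vV => cV; rewrite -(scalerK c0 v) memvZ.
by apply: (orthP [:: x] z); rewrite ?zE ?memvZ // mem_head.
Qed.

Lemma minimal_orth_outside N (x : 'rV[int]_N) (V : {vspace 'rV[rat]_N}) :
  (\dim V < N.-1)%N ->
  exists z, [/\ dot x z = 0, ratv z \notin V &
    forall z', dot x z' = 0 -> (supn z' < supn z)%N -> ratv z' \in V].
Proof.
move=> dV.
pose P l := `[< exists z, [/\ dot x z = 0, ratv z \notin V & supn z = l] >].
have exP : exists l, P l.
  have [z xz zV] := exists_orth_outside x dV.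
  by exists (supn z); apply/asboolP; exists z.
case: (ex_minnP exP) => l /asboolP [z [xz zV zl]] lmin.
exists z; split=> // z' xz'; rewrite zl; apply: contraTT => z'V.
by rewrite -leqNgt; apply: lmin; apply/asboolP; exists z'.
Qed.

(** One scaling step from side l to side l' multiplies K by q^(N-j), which pays
    for the growth of l^(N-j) up to the constant (2 N)^N. *)
Lemma minima_bound_step N j l l' q K C p : (j < N)%N ->
  (l' <= 2 * N * l * q)%N -> (p * l ^ (N - j) <= C * K)%N ->
  (l' * p * l' ^ (N - j.+1) <= (2 * N) ^ N * C * (q ^ (N - j) * K))%N.
Proof.
move=> jN lq bound.
have -> : (l' * p * l' ^ (N - j.+1) = p * l' ^ (N - j))%N.
  by rewrite mulnAC -expnS -subSn // subSS mulnC.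
apply: (@leq_trans (p * (2 * N * l * q) ^ (N - j))).
  by rewrite leq_mul2l leq_exp2r ?lq ?orbT // subn_gt0.
have -> : (p * (2 * N * l * q) ^ (N - j) =
    (2 * N) ^ (N - j) * (p * l ^ (N - j)) * q ^ (N - j))%N.
  by rewrite !(expnMn _ _ (N - j)); ring.
have -> : ((2 * N) ^ N * C * (q ^ (N - j) * K) =
    (2 * N) ^ N * (C * K) * q ^ (N - j))%N by ring.
rewrite leq_mul2r leq_mul ?orbT // leq_pexp2l ?leq_subr //.
by rewrite muln_gt0 (leq_ltn_trans _ jN).
Qed.

(** The vectors are added at the head of ys, and l is the norm of the last one
    added, or 1 at the start.  What makes the induction work is the second group of
    clauses: the minimality of l, and the lower bound for the number of classes of
    the cube of side l.  When a new vector z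
    is added, the cube is first scaled to side |z| modulo the old space; passing
    to the new space then costs nothing, by minimality of z. *)
Lemma successive_minima N (x : 'rV[int]_N) j : (0 < N)%N -> (j <= N.-1)%N ->
  exists ys : seq 'rV[int]_N, exists l K,
  let V := <<map (@ratv N) ys>>%VS in
  [/\ size ys = j, free (map (@ratv N) ys), {in ys, forall y, dot x y = 0},
      sorted (fun a b => supn b <= supn a)%N ys & {in ys, forall y, supn y <= l}%N]
  /\
  [/\ (0 < l)%N, forall z, dot x z = 0 -> (supn z < l)%N -> ratv z \in V,
      packing V l K &
      (\prod_(y <- ys) supn y * l ^ (N - j) <= (2 * N) ^ (N * j) * K)%N].
Proof.
move=> N0; elim: j => [_|j IH jN].
  exists [::], 1%N, 1%N; split; split=> //=.
  - by rewrite nil_free.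
  - move=> z _; rewrite ltnS leqn0 -[_ == _]negbK -lt0n supn_gt0 negbK.
    by move=> /eqP ->; rewrite /ratv map_mx0 mem0v.
  - exact: packing1.
  - by rewrite big_nil exp1n muln0.
have [ys [l [K [[sz fr xys srt yl] [l0 inV pk bound]]]]] := IH (ltnW jN).
have dV : (\dim <<map (@ratv N) ys>> < N.-1)%N.
  by apply: leq_ltn_trans (dim_span _) _; rewrite size_map sz.
have [z [xz zV zmin]] := minimal_orth_outside x dV.
have lz : (l <= supn z)%N by rewrite leqNgt; apply: contra zV => /inV; apply.
have l0z : (0 < l <= supn z)%N by rewrite l0.
have [q zq pk'] := packing_scale N0 l0z pk.
exists (z :: ys), (supn z), (q ^ (N - j) * K)%N; split; split=> //=.
- by rewrite sz.
- by rewrite free_cons zV.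
- by move=> y; rewrite inE => /predU1P [->|/xys].
- rewrite (path_sortedE); last by move=> a b c /[swap]; exact: leq_trans.
  rewrite srt andbT; apply/allP => y /yl; by move=> yl'; exact: leq_trans yl' lz.
- by move=> y; rewrite inE => /predU1P [->//|/yl yl']; exact: leq_trans yl' lz.
- exact: leq_trans l0 lz.
- move=> w xw wz; rewrite span_cons.
  by apply: (subvP (addvSr _ _)); exact: zmin.
- rewrite -sz -[size ys](size_map (@ratv N)).
  apply: packing_sub pk'; first exact: leq_trans l0 lz.
  move=> w wV; apply: zmin; apply: (orthP [:: x] w); rewrite ?mem_head //.
  apply: (subvP _ _ wV); apply/span_subvP => _ /(mapP (s := z :: ys)) [y yin ->].
  apply/orthP => _ /[!inE] /eqP ->.
  by move: yin; rewrite inE => /predU1P [->|/xys].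
rewrite big_cons mulnS expnD; apply: minima_bound_step bound => //.
exact: leq_trans jN (leq_pred N).
Qed.

(** The upper bound 2 N b l for the number of classes turns the last clause of
    the previous lemma into Minkowski's inequality, one factor l cancelling. *)
Lemma short_orthogonal_system N (x : 'rV[int]_N) b m :
  (0 < N)%N -> (m <= N.-1)%N -> (0 < b)%N -> (supn x <= b)%N ->
  exists ys : seq 'rV[int]_N, exists l,
  [/\ size ys = m, free (map (@ratv N) ys), {in ys, forall y, dot x y = 0},
      sorted (fun a b => supn b <= supn a)%N ys & {in ys, forall y, supn y <= l}%N]
  /\ (\prod_(y <- ys) supn y * l ^ (N.-1 - m) <= (2 * N) ^ (N * m).+1 * b)%N.
Proof.
move=> N0 mN b0 xb.
have [ys [l [K [h [l0 inV pk bound]]]]] := successive_minima x N0 mN.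
exists ys, l; split=> //.
have Kb := packing_dot N0 b0 l0 xb inV pk.
rewrite -(leq_pmul2r l0) -mulnA -expnSr -subSn // prednK //.
apply: leq_trans bound _.
have -> : ((2 * N) ^ (N * m).+1 * b * l = (2 * N) ^ (N * m) * (2 * N * b * l))%N.
  by rewrite expnSr; ring.
by rewrite leq_mul2l Kb orbT.
Qed.

(** * Counting systems of vectors *)

Lemma size_supn_le N Y (r : seq 'rV[int]_N) : uniq r ->
  {in r, forall z, supn z <= Y}%N -> (size r <= (2 * Y).+1 ^ N)%N.
Proof.
move=> ur rY.
pose g (z : 'rV[int]_N) : {ffun 'I_N -> 'I_(2 * Y).+1} :=
  [ffun i => inord (absz (z 0 i + Y%:Z))].
have g_inj : {in r &, injective g}.
  move=> z z' /rY /supn_leP zY /rY /supn_leP z'Y /ffunP eqg.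
  apply/rowP => i; have := congr1 val (eqg i); rewrite !ffunE /=.
  move: (zY i) (z'Y i); move: (z 0 i) (z' 0 i) => a a' aY a'Y.
  by rewrite !inordK; lia.
have := card_uniqP (s := map g r); rewrite map_inj_in_uniq // => /(_ ur).
rewrite size_map => <-; apply: leq_trans (max_card _) _.
by rewrite card_ffun !card_ord.
Qed.

Lemma exists_box N Y : exists2 r : seq 'rV[int]_N, uniq r &
  forall z, (z \in r) = (supn z <= Y)%N.
Proof.
pose g (f : {ffun 'I_N -> 'I_(2 * Y).+1}) : 'rV[int]_N :=
  \row_i ((f i)%:Z - Y%:Z).
exists [seq z <- undup (codom g) | supn z <= Y]%N.
  by rewrite filter_uniq ?undup_uniq.
move=> z; rewrite mem_filter mem_undup andb_idr // => /supn_leP zY.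
apply/codomP; exists [ffun i => inord (absz (z 0 i + Y%:Z))].
apply/rowP => i; rewrite mxE ffunE; move: (zY i); move: (z 0 i) => a aY.
by rewrite inordK; lia.
Qed.

(** Halving Y: the vectors of norm between Y/2 and Y number O(Y^N) and contribute
    O(Y^(N-s)), and the rest is at most 2^(-(N-s)) < 1 times the bound for Y. *)
Lemma sum_supn_powR (R : realType) N (s : R) : 0 <= s < N%:R ->
  exists2 C : R, 0 <= C & forall Y (r : seq 'rV[int]_N), uniq r ->
    {in r, forall z, 0 < supn z <= Y}%N ->
    \sum_(z <- r) (supn z)%:R `^ (- s) <= C * Y%:R `^ (N%:R - s).
Proof.
move=> /andP[s0 sN].
have N0 : (0 < N)%N by rewrite -(ltr0n R) (le_lt_trans s0).
set e := N%:R - s; have e0 : 0 < e by rewrite subr_gt0.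
pose D : R := 3 ^+ N * 2 `^ s; pose dl : R := 2 `^ (- e).
have D0 : 0 <= D by rewrite mulr_ge0 ?exprn_ge0 ?powR_ge0.
have dl1 : dl < 1.
  rewrite /dl powRN invf_lt1 ?powR_gt0 //.
  rewrite -[ltLHS](powRr0 2) /powR pnatr_eq0 /= ltr_expR.
  by rewrite ltr_pM2r ?ln_gt0 ?ltr1n.
(* C is the fixed point of the recursion C dl + D, with D for the outer half. *)
pose C := D / (1 - dl).
have CE : C * dl + D = C by rewrite /C; field; rewrite subr_eq0 gt_eqF.
have C0 : 0 <= C by rewrite divr_ge0 // subr_ge0 ltW.
exists C => // Y; have [k] := ubnP Y; elim: k Y => // k IH Y Yk r ur rY.
have [Y0|Y0] := posnP Y.
  case: r ur rY => [|z r] _ rY; first by rewrite big_nil mulr_ge0 ?powR_ge0.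
  by have := rY z (mem_head _ _); rewrite Y0 => /andP[]; lia.
rewrite (bigID (fun z => (supn z <= Y %/ 2)%N)) /= -CE mulrDl.
have YR0 : 0 < Y%:R :> R by rewrite ltr0n.
apply: lerD.
  rewrite -big_filter.
  apply: le_trans (IH (Y %/ 2)%N _ _ _ _) _.
  - by rewrite ltnS in Yk; apply: leq_trans Yk; rewrite ltn_Pdiv.
  - exact: filter_uniq.
  - by move=> z; rewrite mem_filter => /andP[-> /rY /andP[->]].
  rewrite -mulrA ler_wpM2l // /dl powRN -powR_inv1 ?powR_ge0 //.
  rewrite -powRrM mulrN1 -mulN1r powRrM powR_inv1 // -powRM ?invr_ge0 //.
  rewrite ge0_ler_powR ?nnegrE ?(ltW e0) //.
  rewrite mulrC ler_pdivlMr // -natrM ler_nat; exact: leq_divM.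
apply: (@le_trans _ _ (\sum_(z <- [seq z <- r | ~~ (supn z <= Y %/ 2)%N])
    (2 `^ s * Y%:R `^ (- s)))).
  rewrite big_filter; rewrite big_seq_cond [leRHS]big_seq_cond.
  apply: ler_sum => z /andP[zr zY]; have /andP[z0 _] := rY z zr.
  rewrite !powRN -[X in X * _]invrK -invfM lef_pV2 ?posrE ?mulr_gt0 ?invr_gt0 ?powR_gt0 ?ltr0n //.
  rewrite ler_pdivrMl ?powR_gt0 // -powRM //.
  rewrite ge0_ler_powR ?nnegrE // -natrM ler_nat.
  by move: zY; rewrite -ltnNge ltn_divLR //; lia.
rewrite big_const_seq count_predT iter_addr_0 -[leLHS]mulr_natr.
set q := size _.
have qle : (q <= (2 * Y).+1 ^ N)%N.
  apply: size_supn_le; first exact: filter_uniq.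
  by move=> z; rewrite mem_filter => /andP[_ /rY /andP[]].
have qle' : q%:R <= 3 ^+ N * Y%:R ^+ N :> R.
  rewrite -exprMn -natrM -natrX ler_nat; apply: leq_trans qle _.
  by rewrite leq_exp2r; lia.
apply: le_trans (ler_wpM2l _ qle') _; first by rewrite mulr_ge0 ?powR_ge0.
rewrite /D /e powRD; last by apply/implyP; rewrite gt_eqF.
rewrite powR_mulrn ?ler0n // le_eqVlt; apply/orP; left; apply/eqP; ring.
Qed.

(** Induction on m, removing the shortest vector z: the others satisfy the same
    condition with X / |z|, m - 1 and n - 1, and the condition forces
    |z|^n <= X.  The parameter l, which bounds all norms, does not change; it keeps
    the condition of the same form down to the empty system. *)
Lemma count_systems (R : realType) N m n : (0 < N)%N -> (m < n)%N ->
  exists2 c : R, 0 <= c & forall X, (0 < X)%N ->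
  exists2 S : seq (seq 'rV[int]_N),
    (size S)%:R <= c * X%:R `^ (N%:R * m%:R / n%:R) &
    forall ys l, size ys = m -> sorted (fun a b => supn a <= supn b)%N ys ->
      {in ys, forall y, 0 < supn y <= l}%N ->
      (\prod_(y <- ys) supn y * l ^ (n - m) <= X)%N -> ys \in S.
Proof.
move=> N0; elim: m n => [|m IH] n.
  move=> _; exists 1; rewrite ?ler01 // => X X0; exists [:: [::]].
    by rewrite mulr0 mul0r powRr0 mulr1.
  by move=> ys l /size0nil ->; rewrite mem_head.
case: n => // n; rewrite ltnS => mn; have [c c0 IHn] := IH n mn.
have n0 : (0 < n)%N by apply: leq_ltn_trans mn.
have n0R : 0 < n%:R :> R by rewrite ltr0n.
set s := N%:R * m%:R / n%:R in IHn.
have sN : 0 <= s < N%:R.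
  rewrite /s divr_ge0 ?mulr_ge0 //= -mulrA gtr_pMr ?ltr0n //.
  by rewrite ltr_pdivrMr // mul1r ltr_nat.
have [C C0 sumC] := sum_supn_powR sN.
have /choice [S SP] : forall X, exists S : seq (seq 'rV[int]_N), (0 < X)%N ->
    (size S)%:R <= c * X%:R `^ s /\
    forall ys l, size ys = m -> sorted (fun a b => supn a <= supn b)%N ys ->
      {in ys, forall y, 0 < supn y <= l}%N ->
      (\prod_(y <- ys) supn y * l ^ (n - m) <= X)%N -> ys \in S.
  move=> X; have [->|X0] := posnP X; first by exists [::].
  by have [S ? ?] := IHn X X0; exists S.
exists (c * C); first exact: mulr_ge0.
move=> X X0; have XR0 : 0 < X%:R :> R by rewrite ltr0n.
have [box ubox boxP] := exists_box N X.
(* The possible shortest vectors. *)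
pose r := [seq z <- box | (0 < supn z)%N && (supn z ^ n.+1 <= X)%N].
exists (flatten [seq map (cons z) (S (X %/ supn z)) | z <- r]%N); last first.
  move=> [//|z t] l [szt] srt tl; rewrite big_cons subSS => prodX.
  have /andP[z0 zl] := tl z (mem_head _ _).
  move: srt; rewrite /= path_sortedE; last first.
    by move=> a b d ab bd; exact: leq_trans ab bd.
  move=> /andP[/allP zt srt].
  have tl' : {in t, forall y, 0 < supn y <= l}%N.
    by move=> y yt; apply: tl; rewrite inE yt orbT.
  have prodt : (\prod_(y <- t) supn y * l ^ (n - m) <= X %/ supn z)%N.
    by rewrite leq_divRL // mulnC mulnA.
  have zX : (supn z ^ n.+1 <= X)%N.
    apply: leq_trans prodX; rewrite -mulnA expnS leq_mul2l; apply/orP; right.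
    rewrite -[in leqLHS](subnKC (ltnW mn)) expnD.
    rewrite leq_mul ?leq_exp2r ?subn_gt0 // -szt -count_predT -iter_muln_1 -big_const_seq.
    rewrite big_seq [leqRHS]big_seq; apply: leq_prod => y yt; exact: zt.
  have zX1 : (supn z <= X)%N by apply: leq_trans zX; rewrite -[leqLHS]expn1 leq_pexp2l.
  apply/flattenP; exists (map (cons z) (S (X %/ supn z)%N)).
    by apply: map_f; rewrite mem_filter z0 zX boxP.
  apply: map_f; have [|_ inS] := SP (X %/ supn z)%N; first by rewrite divn_gt0.
  exact: (inS t l).
rewrite size_flatten /shape -map_comp sumnE big_map natr_sum.
under eq_bigr do rewrite /= size_map.
pose Y := Num.truncn (X%:R `^ (n.+1%:R^-1) : R).
have YX : Y%:R <= X%:R `^ n.+1%:R^-1 :> R by rewrite truncn_le ?powR_ge0.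
apply: (@le_trans _ _ (\sum_(z <- r) c * X%:R `^ s * (supn z)%:R `^ (- s))).
  rewrite big_seq [leRHS]big_seq; apply: ler_sum => z.
  rewrite mem_filter => /andP[/andP[z0 zX] _].
  have zX1 : (supn z <= X)%N by apply: leq_trans zX; rewrite -[leqLHS]expn1 leq_pexp2l.
  have [|le _] := SP (X %/ supn z)%N; first by rewrite divn_gt0.
  apply: (le_trans le); rewrite -mulrA ler_wpM2l // powRN.
  rewrite ler_pdivlMr ?powR_gt0 ?ltr0n // -powRM //.
  have /andP[s0 _] := sN.
  by rewrite ge0_ler_powR ?nnegrE // -natrM ler_nat leq_divM.
rewrite -mulr_sumr.
have h := sumC Y r (filter_uniq _ ubox).
apply: le_trans (ler_wpM2l _ (h _)) _.
- by rewrite mulr_ge0 ?powR_ge0.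
- move=> z; rewrite mem_filter => /andP[/andP[z0 zX] _]; rewrite z0 /=.
  rewrite truncn_ge_nat ?powR_ge0 //.
  have -> : (supn z)%:R = (((supn z)%:R : R) `^ n.+1%:R) `^ n.+1%:R^-1.
    by rewrite -powRrM divff ?pnatr_eq0 // powRr1.
  by rewrite ge0_ler_powR ?nnegrE ?powR_ge0 ?invr_ge0 // powR_mulrn // -natrX ler_nat.
have -> : c * C * X%:R `^ (N%:R * m.+1%:R / n.+1%:R) =
    c * X%:R `^ s * (C * (X%:R `^ n.+1%:R^-1) `^ (N%:R - s)).
  have -> : N%:R * m.+1%:R / n.+1%:R = s + n.+1%:R^-1 * (N%:R - s) :> R.
    by rewrite /s; field; rewrite gt_eqF ?gt_eqF //= ltr_pwDr ?ler0n.
  rewrite powRD ?powRrM; last by rewrite (gt_eqF XR0) implybT.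
  ring.
rewrite !ler_wpM2l ?mulr_ge0 ?powR_ge0 //.
by have /andP[_ ?] := sN; rewrite ge0_ler_powR ?nnegrE ?powR_ge0 // subr_ge0 ltW.
Qed.

(** * Covering the points of bounded height *)

Lemma cover_by_points (R : realType) n : (0 < n)%N ->
  exists c : R, forall B : R, 1 <= B ->
    exists planes : seq (linear_subvariety n),
      [/\ forall L, L \in planes -> is_plane 0 L,
          (size planes)%:R <= c * B `^ ((n%:R + 1) * (n%:R - 0%:R) / n%:R) &
          forall P : linear_subvariety n, is_point P -> height_le P B ->
            exists2 L, L \in planes & (P <= L)%VS].
Proof.
move=> n0.
have -> : (n%:R + 1) * (n%:R - 0%:R) / n%:R = n.+1%:R :> R.
  by rewrite subr0 natr1 mulfK // pnatr_eq0 -lt0n.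
exists (3 ^+ n.+1) => B B1; set b := Num.truncn B.
have B0 : 0 <= B := le_trans ler01 B1.
have b0 : (0 < b)%N by rewrite truncn_ge_nat.
have bB : b%:R <= B by rewrite truncn_le.
have [box ubox boxP] := exists_box n.+1 b.
exists [seq L <- [seq <[ratv z]>%VS | z <- box] | is_plane 0 L]; split.
- by move=> L; rewrite mem_filter => /andP[].
- apply: (@le_trans _ _ ((2 * b).+1 ^ n.+1)%:R).
    rewrite ler_nat size_filter; apply: leq_trans (count_size _ _) _.
    by rewrite size_map; apply: size_supn_le => // z; rewrite boxP.
  rewrite powR_mulrn // -exprMn natrX lerXn2r ?nnegrE ?mulr_ge0 //.
  apply: (@le_trans _ _ (3 * b%:R)); last by rewrite ler_wpM2l.
  by rewrite -natrM ler_nat; lia.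
move=> P ptP [x [x0 PE xB]]; exists P => //.
rewrite mem_filter [X in X && _]ptP /=; apply/mapP; exists x => //.
by rewrite boxP; exact: supn_le_truncn.
Qed.

Lemma cover_by_planes (R : realType) n k : (0 < k <= n)%N ->
  exists c : R, forall B : R, 1 <= B ->
    exists planes : seq (linear_subvariety n),
      [/\ forall L, L \in planes -> is_plane k L,
          (size planes)%:R <= c * B `^ ((n%:R + 1) * (n%:R - k%:R) / n%:R) &
          forall P : linear_subvariety n, is_point P -> height_le P B ->
            exists2 L, L \in planes & (P <= L)%VS].
Proof.
move=> /andP[k0 kn]; set m := (n - k)%N.
have mn : (m < n)%N by rewrite /m; lia.
have [c c0 countS] := @count_systems R n.+1 m n isT mn.
have -> : (n%:R + 1) * (n%:R - k%:R) / n%:R = n.+1%:R * m%:R / n%:R :> R.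
  by rewrite natr1 natrB.
set e := _ / _ in countS *; have e0 : 0 <= e by rewrite divr_ge0 ?mulr_ge0.
pose A := ((2 * n.+1) ^ (n.+1 * m).+1)%N.
exists (c * A%:R `^ e) => B B1; set b := Num.truncn B.
have B0 : 0 <= B := le_trans ler01 B1.
have b0 : (0 < b)%N by rewrite truncn_ge_nat.
have bB : b%:R <= B by rewrite truncn_le.
have [|S sizeS inS] := countS (A * b)%N; first by rewrite muln_gt0 b0 expn_gt0.
exists [seq L <- [seq orth (rev ys) | ys <- S] | is_plane k L]; split.
- by move=> L; rewrite mem_filter => /andP[].
- apply: (@le_trans _ _ (size S)%:R).
    rewrite ler_nat size_filter; apply: leq_trans (count_size _ _) _.
    by rewrite size_map.
  apply: le_trans sizeS _; rewrite -mulrA ler_wpM2l // -powRM //.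
  by rewrite ge0_ler_powR ?nnegrE ?mulr_ge0 // natrM ler_wpM2l.
move=> P _ [x [x0 -> xB]].
have xb := supn_le_truncn B0 xB.
have mN : (m <= n.+1.-1)%N by rewrite leq_subr.
have [ys [l [[sz fr xys srt yl] bound]]] :=
  short_orthogonal_system (isT : 0 < n.+1)%N mN b0 xb.
exists (orth ys); last first.
  rewrite -memvE -[map_mx _ _]/(ratv x).
  by apply/orthP => y /xys; rewrite dotC.
rewrite mem_filter /is_plane dim_orth_free // sz.
apply/andP; split; first by apply/eqP; rewrite /m; lia.
(* Counting starts from the shortest vector, which is last in ys. *)
apply/mapP; exists (rev ys); last by rewrite revK.
apply: (inS _ l).
- by rewrite size_rev.
- by rewrite rev_sorted.
- move=> y; rewrite mem_rev => yin; rewrite yl // andbT supn_gt0.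
  apply/eqP => y0; have := free_not0 fr (map_f (@ratv n.+1) yin).
  by rewrite y0 /ratv map_mx0 eqxx.
by rewrite (perm_big ys) ?perm_rev //; exact: bound.
Qed.

Theorem lemma3p1 (R : realType) (n k : nat) (hn : (1 <= n)%N) (hk : (k <= n)%N) :
  exists c : R, forall B : R, 1 <= B ->
    exists planes : seq (linear_subvariety n),
      [/\ forall L, L \in planes -> is_plane k L,
          (size planes)%:R <= c * B `^ ((n%:R + 1) * (n%:R - k%:R) / n%:R) &
          forall P : linear_subvariety n, is_point P -> height_le P B ->
            exists2 L, L \in planes & (P <= L)%VS].
Proof.
have [->|k0] := posnP k; first exact: cover_by_points.
by apply: cover_by_planes; rewrite k0.
Qed.
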